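(* Let $n$ be the number of vertices and $k$ the number of parts, with $k=o(n/\log n)$, and let $\alpha=o(\min\{n/k,k\})$. Then any $\alpha$-approximation randomized composable coreset for the minimum vertex cover problem has size $\Omega(n/\alpha)$.
   Context: A random $k$-partitioning of the edge set $E$ of a graph $G(V,E)$ assigns each edge independently to one of $k$ sets $E^{(1)},\dots,E^{(k)}$ uniformly at random; $G^{(i)}:=G(V,E^{(i)})$. A randomized composable coreset for vertex cover is an algorithm which, given a graph $H$, outputs a subgraph of $H$ together with a set of vertices (a fixed solution) to be added directly to the final vertex cover; its size is the number of edges of the subgraph plus the number of vertices/edges of the fixed solution. It is $\alpha$-approximate if, for every graph $G$ and a random $k$-partitioning of $G$, one can obtain from the union of the outputs on $G^{(1)},\dots,G^{(k)}$ (the fixed vertices together with a vertex cover of the union of the subgraphs) a vertex cover of $G$ of size at most $\alpha\cdot\mathrm{VC}(G)$ with high probability, where $\mathrm{VC}(G)$ is the minimum vertex cover size. *)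

(* Defs.v *)
From mathcomp Require Import all_boot all_order all_algebra.
From mathcomp Require Import all_classical all_reals all_analysis.

Set Implicit Arguments.
Unset Strict Implicit.
Unset Printing Implicit Defensive.

Import Order.TTheory GRing.Theory Num.Theory.
Import numFieldNormedType.Exports.

Local Open Scope ring_scope.

(* A simple graph on the vertex set 'I_n is its set of edges,
   an edge being a two-element set of vertices; all the graphs below are
   spanning, so that a subgraph is just a subset of edges. *)

Definition edge (n : nat) := {e : {set 'I_n} | #|e| == 2%N}.

Definition graph (n : nat) := {set edge n}.

Definition vertex_cover n (G : graph n) (C : {set 'I_n}) : bool :=
  [forall e in G, ~~ [disjoint val e & C]].

Definition VC n (G : graph n) : nat :=
  #|[arg min_(C < [set: 'I_n] | vertex_cover G C) #|C|]|.

(* A subgraph and a fixed solution. *)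
Definition output (n : nat) := (graph n * {set 'I_n})%type.

Definition output_size n (y : output n) : nat := (#|y.1| + #|y.2|)%N.

(* A possibly randomized algorithm is given by the law of its output on each
   input graph; a deterministic one is the case of Dirac masses.  No
   computational restriction is imposed. *)
Record coreset (R : realType) (n : nat) := Coreset {
  law :> graph n -> output n -> R;
  law_ge0 : forall H y, 0 <= law H y;
  law_sum1 : forall H, \sum_y law H y = 1;
  law_sub : forall H y, law H y != 0 -> y.1 \subset H }.

(* The largest size of an output that occurs with positive probability. *)
Definition coreset_size (R : realType) n (A : coreset R n) : nat :=
  (\max_(H : graph n) \max_(y : output n | (A H y != 0)%R) output_size y)%N.

(* The i-th piece of G under the assignment f.  An assignment labels all pairs
   of vertices; the labels of the non-edges of G are irrelevant, and a uniform
   f labels the edges of G independently and uniformly. *)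
Definition piece n k (G : graph n) (f : {ffun edge n -> 'I_k}) (i : 'I_k) :
  graph n := [set e in G | f e == i].

(* The union of the fixed solutions, together with the vertex cover that the
   rule [cover] returns on the union of the subgraphs. *)
Definition composed_cover n k (cover : graph n -> {set 'I_n})
    (y : {ffun 'I_k -> output n}) : {set 'I_n} :=
  (\bigcup_(i < k) (y i).2) :|: cover (\bigcup_(i < k) (y i).1).

Definition good_cover (R : realType) n (alpha : R) (G : graph n)
    (X : {set 'I_n}) : bool :=
  vertex_cover G X && (#|X|%:R <= alpha * (VC G)%:R).

(* Probability, over a uniform assignment and the independent coins of the
   k runs of the coreset, that the composed cover is good for G. *)
Definition success_prob (R : realType) n k (A : coreset R n)
    (cover : graph n -> {set 'I_n}) (alpha : R) (G : graph n) : R :=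
  #|{ffun edge n -> 'I_k}|%:R^-1 *
  \sum_(f : {ffun edge n -> 'I_k})
    \sum_(y : {ffun 'I_k -> output n}
           | good_cover alpha G (composed_cover cover y))
      \prod_(i < k) A (piece G f i) (y i).

(* "With high probability" is 1 - o(1), uniformly over the graphs on n
   vertices.  The cover rule is fixed before the graph and the partition, is
   otherwise arbitrary (in particular it may return a minimum cover, with any
   tie-breaking, or an approximate one), and only reads the union of the
   subgraphs. *)
Definition approx_coreset (R : realType) (k : nat -> nat) (alpha : nat -> R)
    (A : forall n, coreset R n) : Prop :=
  exists2 cover : forall n, graph n -> {set 'I_n},
    (forall n (H : graph n), vertex_cover H (cover n H)) &
    exists2 eps : nat -> R,
      (eps x @[x --> \oo] --> (0 : R))%classic &
      forall n (G : graph n),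
        1 - eps n <= success_prob (k n) (A n) (cover n) (alpha n) G.

(* Main.v *)
(* N hubs hide in blocks of vertices, each with at most one edge towards each of
   about k/2 classes; the graph is these stars, which have a vertex cover of
   size N, plus one edge e* from a fresh vertex of the block b to a fresh vertex
   of a class, with N a small multiple of n / alpha.  The piece holding e* looks
   like a graph in which e* is the edge of the hub b, the real hub b having no
   edge in this piece with constant probability.
   - The fixed solution of this piece meets few of the hub edges, hence rarely
     e*, which looks like one of them.
   - Its subgraph T is one of few subsets of the potential hub edges, so that
     given all the secrets, T is almost uncorrelated with the presence of most
     of them (the bits are fair and independent of the other pieces).  So T may
     be replaced with the subgraph selected when e* is absent.
   - After this replacement, e* is independent of the assembled cover, whose
     size is a small fraction of n, and is missed with high probability. *)
Require Import Defs.
From mathcomp Require Import all_boot all_order all_algebra.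
From mathcomp Require Import all_classical all_reals all_analysis.
From mathcomp Require Import ring lra zify.
Set Implicit Arguments.
Unset Strict Implicit.
Unset Printing Implicit Defensive.
Import Order.TTheory GRing.Theory Num.Theory.
Import numFieldNormedType.Exports.
Local Open Scope ring_scope.

(** * Averages over finite types *)

(** Expectation under the uniform law. It is 0 on an empty type, hence the inhabitants passed to the
    lemmas that average a constant. *)
Definition avg (R : realType) (T : finType) (F : T -> R) : R :=
  #|T|%:R^-1 * \sum_x F x.

Section Averages.
Variable R : realType.
Implicit Types T U : finType.

Lemma ler_avg T (F F' : T -> R) :
  (forall x, F x <= F' x) -> avg F <= avg F'.
Proof. by move=> le; rewrite ler_wpM2l ?invr_ge0 ?ler_sum. Qed.

Lemma eq_avg T (F F' : T -> R) : F =1 F' -> avg F = avg F'.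
Proof. by move=> eqF; congr (_ * _); apply: eq_bigr => x _. Qed.

Lemma avg_cst T (x0 : T) (r : R) : avg (fun _ : T => r) = r.
Proof.
have T0 : #|T|%:R != 0 :> R by rewrite pnatr_eq0 -lt0n; apply/card_gt0P; exists x0.
by rewrite /avg sumr_const -[X in _ * X]mulr_natl mulKf.
Qed.

Lemma avgD T (F F' : T -> R) : avg (fun x => F x + F' x) = avg F + avg F'.
Proof. by rewrite /avg big_split mulrDr. Qed.

Lemma avgZ T (r : R) (F : T -> R) : avg (fun x => r * F x) = r * avg F.
Proof. by rewrite /avg -mulr_sumr mulrCA. Qed.

Lemma avg_sum T (I : Type) (s : seq I) (P : pred I) (F : T -> I -> R) :
  avg (fun x => \sum_(i <- s | P i) F x i) =
  \sum_(i <- s | P i) avg (fun x => F x i).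
Proof. by rewrite /avg exchange_big mulr_sumr. Qed.

Lemma exchange_avg T U (F : T -> U -> R) :
  avg (fun x => avg (F x)) = avg (fun y => avg (fun x => F x y)).
Proof. by rewrite /avg -!mulr_sumr exchange_big mulrCA. Qed.

Lemma exchange_avg3 T U (V : finType) (F : T -> U -> V -> R) :
  avg (fun x => avg (fun y => avg (F x y))) =
  avg (fun z => avg (fun x => avg (fun y => F x y z))).
Proof. by under eq_avg => x do rewrite exchange_avg; rewrite exchange_avg. Qed.

Lemma avg_pair T U (F : T -> U -> R) :
  avg (fun x => avg (F x)) = avg (fun z : T * U => F z.1 z.2).
Proof.
by rewrite /avg -mulr_sumr pair_big /= card_prod natrM invfM !mulrA.
Qed.

Lemma avg_inj T (h : T -> T) (F : T -> R) :
  injective h -> avg (fun x => F (h x)) = avg F.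
Proof. by move=> hI; rewrite /avg [in RHS](reindex_inj hI). Qed.

(* Uniform labels restricted along an injection are uniform: exchanging the
   values of [f] on the image of [g] with [phi] is an involution. *)
Lemma avg_comp_inj (X E Y : finType) (y0 : Y) (g : X -> E)
    (F : {ffun X -> Y} -> R) : injective g ->
  avg (fun f : {ffun E -> Y} => F [ffun x => f (g x)]) = avg F.
Proof.
move=> gI.
pose h (z : {ffun E -> Y} * {ffun X -> Y}) : {ffun E -> Y} * {ffun X -> Y} :=
  ([ffun e => if [pick x | g x == e] is Some x then z.2 x else z.1 e],
   [ffun x => z.1 (g x)]).
have pickg x : [pick x' | g x' == g x] = Some x.
  by case: pickP => [x' /eqP/gI -> //|/(_ x)]; rewrite eqxx.
have hK : involutive h.
  case=> f phi; congr pair; apply/ffunP => x; rewrite !ffunE /=.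
    by case: pickP => [x' /eqP <-|//]; rewrite ffunE.
  by rewrite pickg.
have /(_ (fun z => F z.2)) := avg_inj _ (inv_inj hK).
rewrite -(avg_pair (fun _ phi => F phi)) (avg_cst [ffun=> y0]) /= => <-.
rewrite -(avg_pair (fun (f : {ffun E -> Y}) _ => F [ffun x => f (g x)])); apply: eq_avg
  => f.
by rewrite (avg_cst [ffun=> y0]).
Qed.

(** Serves to redraw the bits that one machine sees while the bits of the other machines stay
    fixed. *)
Definition mix (X Y : finType) (S : {set X}) (c c' : {ffun X -> Y}) :
  {ffun X -> Y} := [ffun x => if x \in S then c' x else c x].

(** Exchanging the coordinates in [S] between two independent copies is an involution, so the
    mixture is again uniform. *)
Lemma avg_mix (X Y : finType) (y0 : Y) (S : {set X})
    (F : {ffun X -> Y} -> R) :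
  avg F = avg (fun c => avg (fun c' => F (mix S c c'))).
Proof.
pose h (z : {ffun X -> Y} * {ffun X -> Y}) := (mix S z.1 z.2, mix S z.2 z.1).
have hK : involutive h.
  by case=> c c'; rewrite /h /=; congr pair; apply/ffunP => x;
    rewrite !ffunE; case: (x \in S).
have /(_ (fun z => F z.1)) := avg_inj _ (inv_inj hK).
rewrite avg_pair => ->; rewrite -(avg_pair (fun c _ => F c)).
by apply: eq_avg => c; rewrite (avg_cst [ffun=> y0]).
Qed.

Definition upd (X : finType) (Y : Type) (c : {ffun X -> Y}) (p : X) (v : Y) :
  {ffun X -> Y} := [ffun q => if q == p then v else c q].

(** The value at [p] and an independent fresh value are exchangeable. *)
Lemma avg_upd (X Y : finType) (p : X) (F : {ffun X -> Y} -> Y -> R) :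
  avg (fun c => avg (fun v => F (upd c p v) (c p))) =
  avg (fun c => avg (fun v => F c v)).
Proof.
pose h (z : {ffun X -> Y} * Y) := (upd z.1 p z.2, z.1 p).
have hK : involutive h.
  case=> c v; rewrite /h /=; congr pair; rewrite /= ?ffunE ?eqxx //.
  by apply/ffunP => x; rewrite !ffunE; case: eqP => // ->.
rewrite !avg_pair.
exact: (avg_inj (fun z => F z.1 z.2) (inv_inj hK)).
Qed.

Lemma avg_bool (F : bool -> R) : avg F = (F true + F false) / 2.
Proof. by rewrite /avg card_bool big_bool mulrC. Qed.

(** Forcing a bit amounts to conditioning on an event of probability 1/2, whence the factor 2. *)
Lemma avg_upd_bool (X : finType) (p : X) (v : bool)
    (F : {ffun X -> bool} -> R) :
  avg (fun c : {ffun X -> bool} => F (upd c p v)) =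
  2 * avg (fun c : {ffun X -> bool} => (c p == v)%:R * F c).
Proof.
transitivity (2 * avg (fun c : {ffun X -> bool} =>
    avg (fun _ : bool => (c p == v)%:R * F c))); last first.
  by congr (_ * _); apply: eq_avg => c; rewrite (avg_cst true).
rewrite -(avg_upd p (fun (c : {ffun X -> bool}) (_ : bool) => (c p == v)%:R * F c)).
rewrite -avgZ; apply: eq_avg => c.
by rewrite avg_bool !ffunE eqxx; case: v; rewrite /= mul1r mul0r ?addr0 ?add0r
  mulrC divfK.
Qed.

Lemma avg_ffun1 (X Y : finType) (y0 : Y) (x : X) (F : Y -> R) :
  avg (fun f : {ffun X -> Y} => F (f x)) = avg F.
Proof.
transitivity (avg (fun f : {ffun X -> Y} => avg (fun _ : Y => F (f x)))).
  by apply: eq_avg => f; rewrite (avg_cst y0).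
rewrite -(avg_upd x (fun (f : {ffun X -> Y}) (_ : Y) => F (f x))).
rewrite -[RHS](avg_cst ([ffun=> y0] : {ffun X -> Y})).
by apply: eq_avg => f; apply: eq_avg => w; rewrite ffunE eqxx.
Qed.

Lemma avg_ffun2 (X Y : finType) (y0 : Y) (x x' : X) (F : Y -> Y -> R) :
  x != x' ->
  avg (fun f : {ffun X -> Y} => F (f x) (f x')) = avg (fun y => avg (F y)).
Proof.
move=> xx'.
transitivity (avg (fun f : {ffun X -> Y} => avg (fun _ : Y => F (f x) (f x')))).
  by apply: eq_avg => f; rewrite (avg_cst y0).
rewrite -(avg_upd x (fun (f : {ffun X -> Y}) (_ : Y) => F (f x) (f x'))).
rewrite exchange_avg; apply: eq_avg => y; rewrite -(avg_ffun1 y0 x').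
by apply: eq_avg => f; rewrite !ffunE eqxx eq_sym (negbTE xx').
Qed.

Lemma avg_eq (Y : finType) (y : Y) :
  avg (fun y' : Y => (y == y')%:R : R) = #|Y|%:R^-1.
Proof.
rewrite /avg (bigD1 y) //= eqxx big1 ?addr0 ?mulr1 // => w.
by rewrite eq_sym => /negbTE->.
Qed.

End Averages.

(** * Messages about independent bits *)

Section SignedCorrelation.
Variable R : realType.

(** The Gaussian bound on cosh, with a constant weak enough to follow from 1 + y <= exp y alone,
    which gives exp x <= 1 / (1 - x) and exp (- x) <= 1 / (1 + x). *)
Lemma cosh_le (x : R) : 0 <= x <= 1 / 2 ->
  (expR x + expR (- x)) / 2 <= expR (2 * x ^+ 2).
Proof.
move=> /andP[x0 x2].
have px := expR_gt0 x; have pNx := expR_gt0 (- x).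
have e1 : expR x * expR (- x) = 1 by rewrite -expRD subrr expR0.
have h1 := expR_ge1Dx (- x); have h2 := expR_ge1Dx x.
have h3 := expR_ge1Dx (2 * x ^+ 2).
have hx : expR x <= 1 + x + 2 * x ^+ 2 by nra.
have hNx : expR (- x) <= 1 - x + x ^+ 2 by nra.
nra.
Qed.

(** Chernoff-style count: each counted [T] has 1 <= exp (zeta * (h - #|T|)), and the sum of exp (-
    zeta * #|T|) over the subsets of [S] is (1 + exp (- zeta)) ^ #|S|. *)
Lemma card_small_subsets (X : finType) (S : {set X}) (h : nat) (zeta : R) :
  0 <= zeta ->
  #|[set T : {set X} | (T \subset S) && (#|T| <= h)%N]|%:R <=
  expR (zeta * h%:R + expR (- zeta) * #|S|%:R).
Proof.
move=> zeta0; rewrite expRD -[X in X%:R <= _]sum1dep_card natr_sum.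
have le1z : 1 + expR (- zeta) <= expR (expR (- zeta)) by exact: expR_ge1Dx.
have z0 := expR_ge0 (- zeta).
apply: (@le_trans _ _ (expR (zeta * h%:R) *
    \prod_x ((expR (- zeta) *+ (x \in S)) + 1))); last first.
  rewrite ler_wpM2l ?expR_ge0 // (bigID (fun x => x \in S)) /=.
  rewrite [X in _ * X]big1 ?mulr1 => [|x /negbTE->]; last by rewrite add0r.
  rewrite (eq_bigr (fun=> expR (- zeta) + 1)) => [|x ->//].
  rewrite prodr_const [expR (- zeta) * _%:R]mulrC expRM_natl.
  by rewrite lerXn2r ?nnegrE ?expR_ge0 ?addr_ge0 // addrC.
rewrite bigA_distr mulr_sumr [leLHS]big_mkcond /=.
apply: ler_sum => T _; case: ifP => [/andP[TS Th]|_]; last first.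
  rewrite mulr_ge0 ?expR_ge0 // prodr_ge0 // => x _.
  by case: (x \in T); rewrite ?mulrn_wge0.
rewrite (eq_bigr (fun x => if x \in T then expR (- zeta) else 1)) => [|x _].
  rewrite -big_mkcond prodr_const /= -expRM_natl -expRD.
  rewrite -[X in X <= _]expR0 ler_expR.
  have : (#|T|%:R <= h%:R :> R) by rewrite ler_nat.
  by nra.
by case: ifP => // /(fintype.subsetP TS) ->.
Qed.

Definition chi (b : bool) : R := if b then 1 else -1.

(** The exponential moment factors over the independent bits, and each factor is a cosh. *)
Lemma avg_expR_signed_sum (P : finType) (EE : {set P}) (a : P -> R) (lam : R) :
  0 <= lam <= 1 / 2 -> (forall p, 0 <= a p <= 1) ->
  avg (fun c : {ffun P -> bool} =>
    expR (lam * \sum_(p in EE) a p * chi (c p))) <=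
  expR (2 * lam ^+ 2 * #|EE|%:R).
Proof.
move=> lamP aP.
(* The factor 1/2 is the weight of a fair bit; outside [EE] the exponent is 0 and the two values sum
   to 1. *)
pose F p b := expR ((lam * a p * chi b) *+ (p \in EE)) / 2.
have -> : avg (fun c : {ffun P -> bool} =>
    expR (lam * \sum_(p in EE) a p * chi (c p))) = \prod_p \sum_b F p b.
  rewrite bigA_distr_bigA /= /avg mulr_sumr; apply: eq_bigr => c _.
  rewrite /F big_split /= prodr_const card_ffun card_bool mulrC; congr (_ * _).
    rewrite mulr_sumr -expR_sum [in LHS]big_mkcond /=; congr expR.
    by apply: eq_bigr => p _; rewrite mulrA; case: (p \in EE).
  by rewrite natrX exprVn.
rewrite mulrC expRM_natl -prodr_const [leRHS]big_mkcond /=.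
apply: ler_prod => p _; rewrite !big_bool /F /chi /=.
rewrite -mulrDl; case: ifP => pE /=; rewrite ?mulr0n ?mulr1n.
  rewrite mulr1 mulrN1 divr_ge0 ?addr_ge0 ?expR_ge0 //=.
  have lap : 0 <= lam * a p <= lam by have := aP p; nra.
  apply: le_trans (cosh_le _) _; first lra.
  by rewrite ler_expR; nra.
by rewrite expR0; apply/andP; split; lra.
Qed.

(* Think of [m c] as the law of a message [T] sent upon seeing the uniform bits
   [c]: few possible messages reveal little about most of the bits. *)
Lemma signed_correlation_le (P Msg : finType) (EE : {set P})
    (supp : {set Msg}) (m : {ffun P -> bool} -> Msg -> R) (g : P -> Msg -> R)
    (lam t : R) :
  0 < lam <= 1 / 2 -> 0 <= t ->
  (forall c T, 0 <= m c T) -> (forall c, \sum_T m c T = 1) ->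
  (forall c T, m c T != 0 -> T \in supp) ->
  (forall p T, 0 <= g p T <= 1) ->
  avg (fun c : {ffun P -> bool} =>
    \sum_(p in EE) \sum_T g p T * (chi (c p) * m c T)) <=
  t + #|supp|%:R * (expR (2 * lam ^+ 2 * #|EE|%:R - lam * t) / lam).
Proof.
move=> /andP[lam0 lam2] t0 m0 m1 msupp gP.
have m_le1 c T : m c T <= 1.
  by rewrite -(m1 c) (bigD1 T) //= lerDl sumr_ge0.
pose S (c : {ffun P -> bool}) T := \sum_(p in EE) g p T * chi (c p).
(* Truncation at [t]: S - t <= exp (lam * (S - t)) / lam, and since m <= 1 this excess is paid at
   most once for each message of [supp]. *)
have mS c T : m c T * S c T <=
    m c T * t + (T \in supp)%:R * (expR (lam * S c T) * (expR (- lam * t) / lam)).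
  have [-> |mn0] := eqVneq (m c T) 0.
    by rewrite !mul0r add0r mulr_ge0 // mulr_ge0 ?divr_ge0 ?expR_ge0 ?ltW.
  rewrite (msupp _ _ mn0) mul1r mulrA -expRD.
  have e := expR_ge1Dx (lam * S c T + - lam * t).
  have e0 : 0 <= expR (lam * S c T + - lam * t) / lam.
    by rewrite divr_ge0 ?expR_ge0 ?ltW.
  have : S c T - t <= expR (lam * S c T + - lam * t) / lam.
    by rewrite ler_pdivlMr //; nra.
  have := m0 c T; have := m_le1 c T; nra.
apply: (@le_trans _ _ (avg (fun c : {ffun P -> bool} => t + \sum_(T in supp)
    expR (- lam * t) / lam * expR (lam * S c T)))).
  apply: ler_avg => c; rewrite exchange_big /=.
  rewrite -[X in X + _](mulr1 t) -(m1 c) mulr_sumr [X in _ + X]big_mkcond -big_split /=.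
  apply: ler_sum => T _; have := mS c T.
  rewrite [X in X <= _ -> _](_ : _ = \sum_(p in EE) g p T * (chi (c p) * m c T)).
    case: ifP => _ /le_trans; apply; rewrite /= le_eqVlt; apply/orP; left;
      by apply/eqP; ring.
  by rewrite /S mulr_sumr; apply: eq_bigr => p _; ring.
rewrite avgD avg_cst ?lerD2l; last exact: [ffun=> true].
rewrite avg_sum mulr_natl -sumr_const; apply: ler_sum => T _.
rewrite avgZ.
have -> : expR (2 * lam ^+ 2 * #|EE|%:R - lam * t) / lam =
    expR (- lam * t) / lam * expR (2 * lam ^+ 2 * #|EE|%:R).
  by rewrite addrC expRD mulrAC mulNr.
rewrite ler_wpM2l ?divr_ge0 ?expR_ge0 ?(ltW lam0) //.
by apply: avg_expR_signed_sum => //; rewrite (ltW lam0).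
Qed.

End SignedCorrelation.

(** * Product laws and vertex covers *)

Section ProductLaw.
Variables (R : realType) (I O : finType).
Implicit Types (L : I -> O -> R) (F : {ffun I -> O} -> R).

Definition expect L F : R := \sum_(y : {ffun I -> O}) \prod_i L i (y i) * F y.

Lemma expect1 L : (forall i, \sum_z L i z = 1) -> expect L (fun=> 1) = 1.
Proof.
move=> L1; rewrite /expect; under eq_bigr => y _ do rewrite mulr1.
by rewrite -bigA_distr_bigA big1.
Qed.

Lemma ler_expect L F F' : (forall i z, 0 <= L i z) ->
  (forall y, F y <= F' y) -> expect L F <= expect L F'.
Proof.
by move=> L0 leF; apply: ler_sum => y _; rewrite ler_wpM2l ?prodr_ge0.
Qed.

Lemma ler_expect_pos L F F' : (forall i z, 0 <= L i z) ->
  (forall y : {ffun I -> O}, (forall i, L i (y i) != 0) -> F y <= F' y) ->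
  expect L F <= expect L F'.
Proof.
move=> L0 leF; apply: ler_sum => y _.
have [/prodf_neq0 Ly|] := boolP (\prod_i L i (y i) != 0).
  by rewrite ler_wpM2l ?prodr_ge0 ?leF // => i; apply: Ly.
by rewrite negbK => /eqP ->; rewrite !mul0r.
Qed.

Lemma expectD L F F' :
  expect L (fun y => F y + F' y) = expect L F + expect L F'.
Proof. by rewrite -big_split; apply: eq_bigr => y _; rewrite mulrDr. Qed.

(** Coordinate [i] is exchanged with an independent copy. As it is overwritten afterwards, [L'] may
    carry any normalized weight there. *)
Lemma expect_resample (i : I) L L' F :
  (forall l, l != i -> L l =1 L' l) -> \sum_z L' i z = 1 ->
  expect L F = \sum_z L i z * expect L' (fun y => F (upd y i z)).
Proof.
move=> eqL L'1.
pose H (u : {ffun I -> O} * O) :=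
  L i (u.1 i) * \prod_(l | l != i) L' l (u.1 l) * L' i u.2 * F u.1.
pose h (u : {ffun I -> O} * O) := (upd u.1 i u.2, u.1 i).
have hK : involutive h.
  case=> y z; rewrite /h /=; congr pair; rewrite ?ffunE ?eqxx //.
  by apply/ffunP => l; rewrite !ffunE; case: eqP => // ->.
transitivity (\sum_u H u).
  rewrite -(pair_big xpredT xpredT (fun y z => H (y, z))) /=.
  apply: eq_bigr => y _; rewrite /H /= -mulr_suml -mulr_sumr L'1 mulr1.
  rewrite (bigD1 i) //=; congr (_ * _ * _).
  by apply: eq_bigr => l li; rewrite eqL.
rewrite (reindex_inj (inv_inj hK)) /=.
rewrite -(pair_big xpredT xpredT (fun y z => H (h (y, z)))) exchange_big /=.
apply: eq_bigr => z _; rewrite mulr_sumr; apply: eq_bigr => y _.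
rewrite /H /h /= ffunE eqxx [in RHS](bigD1 i) //=.
rewrite (eq_bigr (fun l => L' l (y l))) => [|l /negbTE li]; first by ring.
by rewrite ffunE li.
Qed.

Lemma expect_proj (i : I) L (F : O -> R) : (forall i, \sum_z L i z = 1) ->
  expect L (fun y => F (y i)) = \sum_z L i z * F z.
Proof.
move=> L1; rewrite (@expect_resample i L L) //; apply: eq_bigr => z _.
rewrite /expect; under eq_bigr => y _ do rewrite ffunE eqxx.
rewrite -mulr_suml -[X in _ * (X * _)](_ : expect L (fun=> 1) = _).
  by rewrite expect1 // mul1r.
by apply: eq_bigr => y _; rewrite mulr1.
Qed.

End ProductLaw.

(** The elements that are not the first component of a colliding pair are mapped injectively into
    [Z]; there are at most as many others as colliding pairs. *)
Lemma card_preim_le (X Y : finType) (S : {set X}) (f : X -> Y) (Z : {set Y}) :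
  (#|[set x in S | f x \in Z]| <= #|Z| +
    #|[set u : X * X | [&& u.1 \in S, u.2 \in S, u.1 != u.2 & f u.1 == f u.2]]|)%N.
Proof.
set W := [set u : X * X | _].
pose V := [set u.1 | u in W].
have -> : [set x in S | f x \in Z] =
    ([set x in S | f x \in Z] :\: V) :|: ([set x in S | f x \in Z] :&: V).
  by rewrite finset.setUC finset.setID.
apply: leq_trans (leq_card_setU _ _) _; apply: leq_add; last first.
  by apply: leq_trans (subset_leq_card (finset.subsetIr _ _)) (leq_imset_card _ _).
rewrite -(card_in_imset (f := f)); last first.
  move=> x x' /finset.setDP[xS xV] /finset.setDP[x'S _] ff'; apply/eqP.
  apply: contraNT xV => xx'; apply/imsetP; exists (x, x') => //.
  move: xS x'S; rewrite !inE => /andP[xS _] /andP[x'S _].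
  by apply/and4P; split => //; apply/eqP.
apply/subset_leq_card/fintype.subsetP => y /imsetP[x /finset.setDP[]].
by rewrite inE => /andP[_ fx] _ ->.
Qed.

(** * Minimum vertex covers *)

Lemma vertex_coverT n (G : graph n) : vertex_cover G [set: 'I_n].
Proof.
apply/forallP => e; apply/implyP => _; rewrite disjoint_sym.
have : (0 < #|val e|)%N by rewrite (eqP (valP e)).
move/card_gt0P => [x xe]; apply/negP => /disjointFr/(_ (finset.in_setT x)).
by rewrite xe.
Qed.

Lemma VC_le n (G : graph n) (C : {set 'I_n}) :
  vertex_cover G C -> (VC G <= #|C|)%N.
Proof.
move=> GC; rewrite /VC.
by case: arg_minnP => [|C' _ minC']; [exact: vertex_coverT|exact: minC'].
Qed.

Lemma VC_gt0 n (G : graph n) (e : edge n) : e \in G -> (0 < VC G)%N.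
Proof.
move=> eG; rewrite /VC.
case: arg_minnP => [|C /forallP/(_ e)]; first exact: vertex_coverT.
rewrite eG /= => eC _; rewrite card_gt0; apply: contraNneq eC => ->.
by rewrite disjoint_sym finset.disjoints_subset finset.sub0set.
Qed.

(** * The hard graphs *)

Section SlotGraphs.
Variables (n N B D rho : nat).
Variable vtx : ('I_N * 'I_B) + ('I_D * 'I_rho) -> 'I_n.
Hypothesis vtxI : injective vtx.
Local Notation slot := ('I_N * 'I_D)%type.
Local Notation secret := ('I_B * 'I_rho)%type.

(** A slot is a block and a class. With secret (a, r), its potential edge joins vertex a of the
    block to vertex r of the class. A star uses one secret in all the slots of its block, so that a
    designates the hub. *)
Definition lvtx (q : slot) (s : secret) : 'I_n := vtx (inl (q.1, s.1)).
Definition rvtx (q : slot) (s : secret) : 'I_n := vtx (inr (q.2, s.2)).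

Lemma card_slot_edge q s : #|[set lvtx q s; rvtx q s]%SET| == 2%N.
Proof. by rewrite cards2 /lvtx /rvtx (inj_eq vtxI). Qed.

Definition sedge (q : slot) (s : secret) : edge n :=
  exist (fun e : {set 'I_n} => #|e| == 2%N) _ (card_slot_edge q s).

(** Blocks and classes occupy disjoint sets of vertices, so an edge determines its slot whatever the
    secrets. *)
Lemma sedge_inj q s q' s' : sedge q s = sedge q' s' -> q = q'.
Proof.
move=> /(congr1 val) /= /setP e.
have := e (lvtx q s); have := e (rvtx q s).
rewrite !inE !eqxx orbT /= /lvtx /rvtx !(inj_eq vtxI).
case: q q' s s' {e} => [b j] [b' j'] [a r] [a' r'] /=.
by move=> /esym/eqP[-> _] /esym; rewrite orbF => /eqP[-> _].
Qed.

Lemma sedge_fun_inj (sigma : slot -> secret) :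
  injective (fun q => sedge q (sigma q)).
Proof. by move=> q q' /sedge_inj. Qed.

Definition hits (X : {set 'I_n}) (q : slot) (s : secret) : bool :=
  (lvtx q s \in X) || (rvtx q s \in X).

Lemma hits_cover (G : graph n) (X : {set 'I_n}) q s :
  sedge q s \in G -> vertex_cover G X -> hits X q s.
Proof.
move=> eG /forallP/(_ (sedge q s)); rewrite eG /=; apply: contraR.
rewrite negb_or => /andP[lX rX]; rewrite finset.disjoints_subset.
by apply/fintype.subsetP => v; rewrite !inE => /orP[]/eqP->.
Qed.

Lemma hitsS (X Y : {set 'I_n}) q s : X \subset Y -> hits X q s -> hits Y q s.
Proof.
by move=> /fintype.subsetP XY /orP[/XY lY|/XY rY]; rewrite /hits ?lY ?rY ?orbT.
Qed.

Lemma hitsU (X Y : {set 'I_n}) q s :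
  hits (X :|: Y)%SET q s = hits X q s || hits Y q s.
Proof. by rewrite /hits !inE orbACA. Qed.

Definition sgraph (sigma : slot -> secret) (c : slot -> bool) : graph n :=
  [set sedge q (sigma q) | q in [pred q | c q]]%SET.

(** * Pieces of a slot graph *)

Section Pieces.
Variable k : nat.

Definition spiece (sigma : slot -> secret) (c : slot -> bool)
    (phi : slot -> 'I_k) (l : 'I_k) : graph n :=
  [set sedge q (sigma q) | q in [pred q | c q && (phi q == l)]]%SET.

Lemma piece_sgraph sigma c (f : {ffun edge n -> 'I_k}) l :
  piece (sgraph sigma c) f l =
  spiece sigma c [ffun q => f (sedge q (sigma q))] l.
Proof.
apply/setP => e; rewrite inE; apply/andP/imsetP.
  move=> [/imsetP[q qc ->] fq]; exists q => //.
  by rewrite inE ffunE fq andbT.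
move=> [q]; rewrite inE ffunE => /andP[qc fq] ->; split=> //.
by apply/imsetP; exists q.
Qed.

(** A machine sees only the slots with its label, and the secret of such a slot only if its bit is
    on. All comparisons of pieces rest on this. *)
Lemma eq_spiece sigma sigma' (c c' : slot -> bool) (phi : slot -> 'I_k) l :
  (forall q, phi q = l -> c q = c' q) ->
  (forall q, phi q = l -> c q -> sigma q = sigma' q) ->
  spiece sigma c phi l = spiece sigma' c' phi l.
Proof.
move=> cc' ss'; apply/setP => e; apply/imsetP/imsetP => -[q];
  rewrite inE => /andP[cq /eqP pq] ->; exists q; rewrite ?inE ?pq ?eqxx ?andbT.
- by rewrite -cc'.
- by rewrite ss'.
- by rewrite cc'.
- by rewrite ss' ?cc'.
Qed.

(** When this holds, the machine of [p] can see the block of [p] only through [p] itself. *)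
Definition alone (phi : slot -> 'I_k) (p : slot) : bool :=
  [forall q : slot, (q.1 == p.1) && (phi q == phi p) ==> (q == p)].

Lemma aloneP phi p : reflect
  (forall q, q.1 = p.1 -> phi q = phi p -> q = p) (alone phi p).
Proof.
apply: (iffP forallP) => h q.
  by move=> e1 e2; have := h q; rewrite e1 e2 !eqxx => /eqP.
by apply/implyP => /andP[/eqP e1 /eqP e2]; apply/eqP/h.
Qed.

End Pieces.

(* The secret of block [p.1] at slot [p], a fresh secret [t] at the other slots
   of this block. *)
Definition planted (tau : {ffun 'I_N -> secret}) (t : secret) (p q : slot) :
    secret :=
  if q == p then tau p.1 else upd tau p.1 t q.1.

Lemma VC_planted tau t p (c : slot -> bool) :
  (VC (sgraph (planted tau t p) c) <= N.+1)%N.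
Proof.
(* One hub per block, the fresh one in block [p.1], plus the left endpoint of the planted edge. *)
pose C := (lvtx p (tau p.1) |:
  [set vtx (inl (b, (upd tau p.1 t b).1)) | b : 'I_N])%SET.
apply: (@leq_trans #|C|).
  apply: VC_le; apply/forallP => e; apply/implyP => /imsetP[q _ ->].
  apply/negP => /disjointFr/(_ (set21 _ _)) /negP; apply.
  rewrite /planted; case: (eqVneq q p) => [->|qp]; rewrite !inE ?eqxx //.
  by apply/orP; right; apply/imsetP; exists q.1.
apply: leq_trans (leq_card_setU _ _) _; rewrite cards1 add1n ltnS.
by apply: leq_trans (leq_imset_card _ _) _; rewrite card_ord.
Qed.

(** * Success on planted graphs *)

Section Success.
Variables (R : realType) (k : nat) (A : coreset R n).
Variable cover : graph n -> {set 'I_n}.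
Implicit Types (phi : {ffun slot -> 'I_k}) (c : {ffun slot -> bool})
  (tau : {ffun 'I_N -> secret}) (t : secret) (p : slot).

Lemma success_sgraph (alpha : R) (sigma : slot -> secret) (c : slot -> bool)
    (i0 : 'I_k) :
  success_prob k A cover alpha (sgraph sigma c) =
  avg (fun phi => expect (fun l => A (spiece sigma c phi l))
    (fun y => (good_cover alpha (sgraph sigma c) (composed_cover cover y))%:R)).
Proof.
rewrite -(avg_comp_inj i0 _ (@sedge_fun_inj sigma)) /success_prob /avg.
congr (_ * _); apply: eq_bigr => f _; rewrite /expect big_mkcond /=.
apply: eq_bigr => y _; case: ifP; rewrite ?mulr1 ?mulr0 // => _.
by apply: eq_bigr => l _; rewrite piece_sgraph.
Qed.

Local Notation block_piece tau c phi l :=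
  (spiece (fun q : slot => tau q.1) c phi l).

(** To the other machines the planted graph is a union of stars in which block [p.1] has the fresh
    secret. *)
Lemma block_piece_planted tau t c phi p l : l != phi p ->
  spiece (planted tau t p) (upd c p true) phi l =
  block_piece (upd tau p.1 t) c phi l.
Proof.
move=> lp; have pl q : phi q = l -> (q == p) = false.
  by move=> e; apply: contraNF lp => /eqP <-; rewrite e.
by apply: eq_spiece => q /pl qp; rewrite ?ffunE /planted ?qp ?ffunE.
Qed.

(** To its own machine the planted edge looks like an edge of a star: no other edge of the block is
    there to betray a different hub. *)
Lemma block_piece_planted_alone tau t c phi p : alone phi p ->
  spiece (planted tau t p) (upd c p true) phi (phi p) =
  block_piece tau (upd c p true) phi (phi p).
Proof.
move=> /aloneP ph; apply: eq_spiece => q // e _.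
rewrite /planted; case: (eqVneq q p) => [-> //|qp].
by rewrite ffunE; case: eqP => // e1; rewrite (ph q) ?eqxx in qp.
Qed.

(** Without the edge at [p], this machine sees nothing of block [p.1], hence nothing of its
    secret. *)
Lemma block_piece_fresh tau t c phi p : alone phi p ->
  block_piece tau (upd c p false) phi (phi p) =
  block_piece (upd tau p.1 t) (upd c p false) phi (phi p).
Proof.
move=> /aloneP ph; apply: eq_spiece => q // e; rewrite !ffunE.
case: (eqVneq q p) => // qp _; case: eqP => // e1.
by rewrite (ph q) ?eqxx in qp.
Qed.

Lemma block_piece_upd_false tau c phi p l : l != phi p ->
  block_piece tau (upd c p false) phi l = block_piece tau c phi l.
Proof.
move=> lp; apply: eq_spiece => // q e; rewrite ffunE; case: eqP => // qp.
by rewrite -e qp eqxx in lp.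
Qed.

(* The cover assembled from all outputs but the fixed solution of machine [i],
   whose subgraph is replaced by [T]. *)
Definition rest_cover (i : 'I_k) (T : graph n) (y : {ffun 'I_k -> output n}) :
    {set 'I_n} :=
  (\bigcup_(l < k | l != i) (y l).2 :|:
   cover (T :|: \bigcup_(l < k | l != i) (y l).1))%SET.

Lemma composed_coverE (i : 'I_k) (y : {ffun 'I_k -> output n}) :
  composed_cover cover y = ((y i).2 :|: rest_cover i (y i).1 y)%SET.
Proof.
by rewrite /composed_cover /rest_cover (bigD1 i) //= [in X in cover X](bigD1 i)
  //= finset.setUA.
Qed.

Lemma rest_cover_upd (i : 'I_k) T (y : {ffun 'I_k -> output n}) z :
  rest_cover i T (upd y i z) = rest_cover i T y.
Proof.
rewrite /rest_cover; congr (_ :|: cover (_ :|: _))%SET;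
  by apply: eq_bigr => l /negbTE li; rewrite ffunE li.
Qed.

(** Machine [phi p] gets a dummy law, on the empty graph, which keeps a product over all machines
    while ignoring its actual input. *)
Definition other_laws tau t c phi p (l : 'I_k) : output n -> R :=
  A (if l == phi p then finset.set0 else block_piece (upd tau p.1 t) c phi l).

(** As a function of [T], this is the test used to detect the presence of the planted edge from the
    subgraph of its machine. *)
Definition rest_hits tau t c phi p (Q : R) (T : graph n) : R :=
  expect (other_laws tau t c phi p) (fun y =>
    (hits (rest_cover (phi p) T y) p (tau p.1) &&
     (#|rest_cover (phi p) T y|%:R <= Q))%:R).

Definition fixed_hits tau c phi p : R :=
  \sum_z A (block_piece tau c phi (phi p)) z * (hits z.2 p (tau p.1))%:R.

Definition subgraph_gain tau t c phi p (Q : R) : R :=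
  \sum_z A (block_piece tau (upd c p true) phi (phi p)) z *
    rest_hits tau t c phi p Q z.1 -
  \sum_z A (block_piece tau (upd c p false) phi (phi p)) z *
    rest_hits tau t c phi p Q z.1.

Definition null_hits tau c phi p s (Q : R) : R :=
  expect (fun l => A (block_piece tau c phi l)) (fun y =>
    (hits (composed_cover cover y) p s && (#|composed_cover cover y|%:R <= Q))%:R).

(** On success, the planted edge is met by the fixed solution of its machine or by the rest of the
    cover. In the latter case the subgraph is replaced with one selected in the absence of the edge,
    at the cost of [subgraph_gain]. Putting the fixed solution of the machine back then adds at most
    [h] vertices. *)
Lemma planted_success_le tau t c phi p (alpha : R) (h : nat) :
  0 <= alpha -> (forall H z, A H z != 0 -> (output_size z <= h)%N) ->
  alone phi p ->
  expect (fun l => A (spiece (planted tau t p) (upd c p true) phi l))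
    (fun y => (good_cover alpha (sgraph (planted tau t p) (upd c p true))
      (composed_cover cover y))%:R) <=
  fixed_hits tau (upd c p true) phi p +
  subgraph_gain tau t c phi p (alpha * N.+1%:R) +
  null_hits (upd tau p.1 t) (upd c p false) phi p (tau p.1)
    (alpha * N.+1%:R + h%:R).
Proof.
move=> alpha0 Ah ph; set i := phi p; set Q := alpha * N.+1%:R.
set G := sgraph _ _.
have e_in : sedge p (tau p.1) \in G.
  apply/imsetP; exists p; last by rewrite /planted eqxx.
  by rewrite inE ffunE eqxx.
pose L l : output n -> R := A (spiece (planted tau t p) (upd c p true) phi l).
rewrite -/L.
apply: (@le_trans _ _ (expect L (fun y => (hits (y i).2 p (tau p.1))%:R +
    (hits (rest_cover i (y i).1 y) p (tau p.1) &&
     (#|rest_cover i (y i).1 y|%:R <= Q))%:R))).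
  apply: ler_expect => [l z|y]; first exact: law_ge0.
  rewrite -natrD ler_nat; case: (boolP (good_cover _ _ _)) => //.
  rewrite (composed_coverE i) => /andP[/(hits_cover e_in)].
  rewrite hitsU; case: (hits (y i).2 _ _) => //= -> Xle; rewrite add0n lt0b.
  apply: (@le_trans _ _ (alpha * (VC G)%:R)).
    apply: le_trans Xle; rewrite ler_nat subset_leq_card //.
    exact: finset.subsetUr.
  by rewrite ler_wpM2l // ler_nat VC_planted.
rewrite expectD -addrA lerD //.
  rewrite (expect_proj i (fun z : output n => (hits z.2 p (tau p.1))%:R)) /L
    => [|l]; last exact: law_sum1.
  by rewrite block_piece_planted_alone.
have O1 : \sum_z other_laws tau t c phi p i z = 1 by exact: law_sum1.
rewrite (expect_resample (i := i) (L' := other_laws tau t c phi p)) //; last first.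
  move=> l li z; rewrite /L /other_laws (negbTE li).
  by rewrite block_piece_planted // eq_sym.
have updE (z : output n) :
    expect (other_laws tau t c phi p) (fun y =>
      (hits (rest_cover i (upd y i z i).1 (upd y i z)) p (tau p.1) &&
      (#|rest_cover i (upd y i z i).1 (upd y i z)|%:R <= Q))%:R) =
    rest_hits tau t c phi p Q z.1.
  by apply: eq_bigr => y _; rewrite rest_cover_upd ffunE eqxx.
under eq_bigr => z _ do rewrite updE.
rewrite /L block_piece_planted_alone // /subgraph_gain -/i.
rewrite -addrA lerDl addrC subr_ge0.
under eq_bigr => z _ do rewrite -updE.
(* With the edge absent, block [p.1] may take the secret [t] for machine [i] too: all outputs come
   from one graph of stars that does not involve [tau p.1]. *)
pose L0 l : output n -> R := A (block_piece (upd tau p.1 t) (upd c p false) phi l).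
rewrite (_ : \sum_z _ = expect L0 (fun y => 
  (hits (rest_cover i (y i).1 y) p (tau p.1) &&
     (#|rest_cover i (y i).1 y|%:R <= Q))%:R)); last first.
  rewrite (expect_resample (i := i) (L' := other_laws tau t c phi p)) //.
    by rewrite /L0 -block_piece_fresh.
  by move=> l li z; rewrite /L0 /other_laws (negbTE li) block_piece_upd_false.
apply: ler_expect_pos => [l z|y Ly]; first exact: law_ge0.
rewrite ler_nat (composed_coverE i); set X := rest_cover _ _ _.
case: (boolP (hits X _ _ && _)) => // /andP[Xp XQ].
rewrite (hitsS (finset.subsetUr _ _) Xp) lt0b /=.
apply: (@le_trans _ _ ((#|(y i).2| + #|X|)%N%:R)).
  by rewrite ler_nat leq_card_setU.
rewrite natrD addrC lerD // ler_nat.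
by apply: leq_trans (Ah _ _ (Ly i)); rewrite leq_addl.
Qed.

End Success.
End SlotGraphs.

(** * Averaging over the secrets *)

Section Estimates.
Variables (n N B D rho k : nat).
Variable vtx : ('I_N * 'I_B) + ('I_D * 'I_rho) -> 'I_n.
Hypothesis vtxI : injective vtx.
Local Notation slot := ('I_N * 'I_D)%type.
Local Notation secret := ('I_B * 'I_rho)%type.
Variables (p0 : slot) (s0 : secret) (i0 : 'I_k).
Variables (R : realType) (A : coreset R n) (cover : graph n -> {set 'I_n}).
Variable h : nat.
Hypothesis Ah : forall H z, A H z != 0 -> (output_size z <= h)%N.
Local Notation block_piece tau c phi l :=
  (spiece vtxI (fun q : slot => tau q.1) c phi l).
Local Notation labels := {ffun slot -> 'I_k}.
Local Notation bits := {ffun slot -> bool}.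
Local Notation secrets := {ffun 'I_N -> secret}.

Lemma avg_upd_slot_le (F : bits -> labels -> slot -> R) (v : bool) :
  (forall c phi p, 0 <= F c phi p) ->
  avg (fun c => avg (fun phi => avg (fun p => F (upd c p v) phi p))) <=
  2 * avg (fun c => avg (fun phi => avg (fun p => F c phi p))).
Proof.
move=> F0.
rewrite exchange_avg [X in _ <= 2 * X]exchange_avg -avgZ; apply: ler_avg => phi.
rewrite exchange_avg [X in _ <= 2 * X]exchange_avg -avgZ; apply: ler_avg => p.
rewrite (avg_upd_bool p v (fun c => F c phi p)) ler_wpM2l //.
by apply: ler_avg => c; case: eqP; rewrite ?mul1r ?mul0r.
Qed.

Lemma sum_law_le (H : graph n) (F : output n -> R) (a : R) :
  (forall z, A H z != 0 -> F z <= a) -> \sum_z A H z * F z <= a.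
Proof.
move=> Fa; rewrite -[leRHS]mul1r -(law_sum1 A H) mulr_suml; apply: ler_sum => z _.
have [->|Hz] := eqVneq (A H z) 0; first by rewrite !mul0r.
by rewrite ler_wpM2l ?law_ge0 ?Fa.
Qed.

(** * Hits by the fixed solution *)

Definition alone_slots (phi : labels) (i : 'I_k) : {set slot} :=
  [set p | (phi p == i) && alone phi p]%SET.

Lemma sum_aloneE (phi : labels) (F : 'I_k -> slot -> R) :
  \sum_p (alone phi p)%:R * F (phi p) p =
  \sum_i \sum_(p in alone_slots phi i) F i p.
Proof.
rewrite (partition_big phi xpredT) //=; apply: eq_bigr => i _.
rewrite big_mkcond [RHS]big_mkcond; apply: eq_bigr => p _; rewrite inE.
case: eqP => //= ->; case: (alone phi p); by rewrite ?mul1r ?mul0r.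
Qed.

(** The potential edges of two hubs share their right endpoint within one piece, so that a single
    fixed vertex can hit both. *)
Definition collision (tau : secrets) (phi : labels) (u : slot * slot) : bool :=
  [&& u.1.1 != u.2.1, u.1.2 == u.2.2, phi u.1 == phi u.2 &
      (tau u.1.1).2 == (tau u.2.1).2].

(** The alone slots of one machine lie in distinct blocks, so their left endpoints are distinct and
    at most [h] of them are fixed vertices. The same holds on the right up to collisions. *)
Lemma sum_fixed_hits_le (tau : secrets) (c : bits) (phi : labels) :
  \sum_p (alone phi p)%:R * fixed_hits vtxI A tau c phi p <=
  2 * h%:R * k%:R + \sum_u (collision tau phi u)%:R.
Proof.
pose rv q := rvtx vtx q (tau q.1); pose lv q := lvtx vtx q (tau q.1).
pose coll i := [set u : slot * slot | [&& u.1 \in alone_slots phi i,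
  u.2 \in alone_slots phi i, u.1 != u.2 & rv u.1 == rv u.2]]%SET.
rewrite (sum_aloneE phi (fun i p => \sum_z A (block_piece tau c phi i) z *
   (hits vtx z.2 p (tau p.1))%:R)).
apply: (@le_trans _ _ (\sum_i (2 * h%:R + #|coll i|%:R))).
  apply: ler_sum => i _; rewrite exchange_big /=.
  under eq_bigr => z _ do rewrite -mulr_sumr.
  apply: sum_law_le => z /Ah zh.
  have z2h : (#|z.2| <= h)%N by apply: leq_trans zh; rewrite leq_addl.
  rewrite -natr_sum -natrM -natrD ler_nat.
  apply: (@leq_trans (#|[set p in alone_slots phi i | lv p \in z.2]%SET| +
                      #|[set p in alone_slots phi i | rv p \in z.2]%SET|)).
    rewrite -!sum1dep_card !big_mkcondr -big_split /=; apply: leq_sum => p _.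
    by rewrite /hits -/(lv p) -/(rv p); do 2 case: (_ \in _).
  have rvle : (#|[set p in alone_slots phi i | rv p \in z.2]%SET| <=
      #|z.2| + #|coll i|)%N := card_preim_le _ _ _.
  have := card_preim_le (alone_slots phi i) lv z.2.
  rewrite [X in (_ <= _ + X)%N]eq_card0 ?addn0 => [lvle|].
    by apply: leq_trans (leq_add lvle rvle) _; rewrite addnA mul2n -addnn leq_add2r leq_add.
  move=> [p q]; rewrite !inE /=; apply/negP => /and4P[/andP[/eqP pi _]].
  move=> /andP[/eqP qi /aloneP qa] /eqP pq /eqP/vtxI[e _].
  by apply: pq; apply: qa; rewrite // pi qi.
rewrite big_split /= sumr_const card_ord -[X in X + _ <= _]mulr_natr lerD2l.
rewrite -natr_sum -natr_sum ler_nat.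
rewrite (eq_bigr (fun i => \sum_u (u \in coll i))%N); last first.
  by move=> i _; rewrite -sum1_card big_mkcond.
rewrite exchange_big /=; apply: leq_sum => u _.
(* A colliding pair is charged to one machine only, the label of its first slot. *)
apply: (@leq_trans (\sum_i (collision tau phi u && (phi u.1 == i)))%N).
  apply: leq_sum => i _; rewrite inE; case: (boolP [&& _, _, _ & _]) => //.
  case: u => p q /=; rewrite !inE => /and4P[/andP[/eqP pi pa] /andP[/eqP qi qa]].
  move=> pq /eqP/vtxI[e1 e2]; rewrite /collision /= pi qi e1 e2 !eqxx andbT /=.
  rewrite lt0b andbT; apply: contraNneq pq => e.
  by apply/eqP/(aloneP _ _ qa); rewrite // pi qi.
rewrite (bigD1 (phi u.1)) //= eqxx andbT big1 ?addn0 // => i /negbTE.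
by rewrite eq_sym => ->; rewrite andbF.
Qed.

(** N * N * D pairs of slots have a common class. In distinct blocks, they share their label with
    probability 1 / k and, independently, their right vertex with probability 1 / rho. *)
Lemma avg_collision_le :
  avg (fun tau : secrets => avg (fun phi : labels =>
    \sum_u (collision tau phi u)%:R)) <= N%:R * N%:R * D%:R / (k%:R * rho%:R) :> R.
Proof.
have -> : N%:R * N%:R * D%:R =
    \sum_(u : slot * slot) (u.1.2 == u.2.2)%:R :> R.
  rewrite -natr_sum -!natrM; congr _%:R.
  rewrite -(pair_big xpredT xpredT (fun p q : slot => nat_of_bool (p.2 == q.2))) /=.
  transitivity (\sum_(p : slot) N)%N.
    by rewrite sum_nat_const card_prod !card_ord; ring.
  apply: eq_bigr => p _.
  rewrite -(pair_big xpredT xpredT (fun _ j => nat_of_bool (p.2 == j))) /=.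
  rewrite -[LHS]mul1n -[in LHS](card_ord N) mulnC -sum_nat_const; apply: eq_bigr => b _.
  by rewrite (bigD1 p.2) //= eqxx big1 // => j /negbTE; rewrite eq_sym => ->.
under eq_avg => tau do rewrite avg_sum.
rewrite avg_sum mulr_suml; apply: ler_sum => -[p q] _; rewrite /collision /=.
have [e|pq1] /= := eqVneq p.1 q.1.
  under eq_avg => tau do rewrite (avg_cst ([ffun=> i0] : labels)).
  by rewrite (avg_cst ([ffun=> s0] : secrets)) mulr_ge0 ?invr_ge0.
have [pq2|] /= := eqVneq p.2 q.2; last first.
  under eq_avg => tau do rewrite (avg_cst ([ffun=> i0] : labels)).
  by rewrite (avg_cst ([ffun=> s0] : secrets)) mulr_ge0 ?invr_ge0.
rewrite mul1r invfM le_eqVlt; apply/orP; left; apply/eqP.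
have pq : p != q by apply: contraNneq pq1 => ->.
transitivity (avg (fun tau : secrets =>
    ((tau p.1).2 == (tau q.1).2)%:R * avg (fun phi : labels => (phi p == phi q)%:R)) : R).
  by apply: eq_avg => tau; rewrite -avgZ; apply: eq_avg => phi; rewrite andbC -mulnb natrM.
rewrite (avg_ffun2 i0 (fun i j => (i == j)%:R) pq).
have -> : avg (fun i : 'I_k => avg (fun j => (i == j)%:R : R)) = k%:R^-1.
  by under eq_avg => i do rewrite avg_eq; rewrite (avg_cst i0) card_ord.
under eq_avg => tau do rewrite mulrC.
rewrite avgZ (avg_ffun2 s0 (fun s t => (s.2 == t.2)%:R) pq1).
congr (_ * _); transitivity (avg (fun _ : secret => rho%:R^-1 : R)).
  apply: eq_avg => s; rewrite -(avg_pair (fun _ r => (s.2 == r)%:R)) avg_eq card_ord.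
  by rewrite (avg_cst s0.1).
by rewrite (avg_cst s0).
Qed.

Lemma avg_fixed_hits_le :
  avg (fun tau : secrets => avg (fun c : bits =>
    avg (fun phi : labels => avg (fun p : slot =>
    (alone phi p)%:R * fixed_hits vtxI A tau (upd c p true) phi p)))) <=
  2 * ((2 * h%:R * k%:R + N%:R * N%:R * D%:R / (k%:R * rho%:R)) / (N%:R * D%:R)).
Proof.
apply: (@le_trans _ _ (avg (fun tau : secrets => avg (fun phi : labels =>
   2 / (N%:R * D%:R) * (2 * h%:R * k%:R + \sum_u (collision tau phi u)%:R))))).
  apply: ler_avg => tau.
  apply: le_trans (@avg_upd_slot_le (fun c phi p =>
    (alone phi p)%:R * fixed_hits vtxI A tau c phi p) true _) _.
    move=> c phi p; rewrite mulr_ge0 // sumr_ge0 // => z _.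
    by rewrite mulr_ge0 ?law_ge0.
  rewrite /= [leRHS]avgZ -(mulrA 2 _ (avg _)) ler_wpM2l // -avgZ.
  rewrite -[leRHS](avg_cst ([ffun=> true] : bits)).
  apply: ler_avg => c; apply: ler_avg => phi; rewrite /avg card_prod !card_ord natrM.
  by rewrite ler_wpM2l ?invr_ge0 ?mulr_ge0 ?sum_fixed_hits_le.
under eq_avg => tau do rewrite avgZ avgD (avg_cst ([ffun=> i0] : labels)).
rewrite avgZ avgD (avg_cst ([ffun=> s0] : secrets)).
by rewrite mulrA [leRHS]mulrAC ler_wpM2l ?divr_ge0 ?mulr_ge0 // lerD2l avg_collision_le.
Qed.

(** The left endpoint is uniform over the N * B block vertices, the right one over the D * rho class
    vertices. *)
Lemma avg_hits_le (X : {set 'I_n}) :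
  avg (fun p : slot => avg (fun s : secret => (hits vtx X p s)%:R)) <=
  #|X|%:R * ((N%:R * B%:R)^-1 + (D%:R * rho%:R)^-1) :> R.
Proof.
have avgX (T : finType) (f : T -> 'I_n) : injective f ->
    avg (fun x => (f x \in X)%:R) <= #|X|%:R * #|T|%:R^-1 :> R.
  move=> fI; rewrite /avg mulrC ler_wpM2r ?invr_ge0 // -natr_sum ler_nat.
  rewrite -big_mkcond /= sum1dep_card -(card_imset _ fI) subset_leq_card //.
  by apply/fintype.subsetP => v /imsetP[x]; rewrite inE => xX ->.
have := avgX _ (vtx \o inl) (inj_comp vtxI inl_inj).
have := avgX _ (vtx \o inr) (inj_comp vtxI inr_inj).
rewrite !card_prod !card_ord !natrM mulrDr => rX lX.
apply: le_trans (lerD lX rX).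
apply: (@le_trans _ _ (avg (fun p : slot => avg (fun s : secret =>
  (lvtx vtx p s \in X)%:R + (rvtx vtx p s \in X)%:R)))).
  apply: ler_avg => p; apply: ler_avg => s; rewrite /hits -natrD ler_nat.
  by do 2 case: (_ \in _).
under eq_avg => p do rewrite avgD.
rewrite avgD lerD // le_eqVlt; apply/orP; left; apply/eqP.
  transitivity (avg (fun b => avg (fun a => (vtx (inl (b, a)) \in X)%:R)) : R);
    last by rewrite avg_pair; apply: eq_avg => -[].
  rewrite -(avg_pair (fun b j => avg (fun s : secret => (vtx (inl (b, s.1)) \in X)%:R))).
  apply: eq_avg => b; rewrite (avg_cst p0.2).
  rewrite -(avg_pair (fun a r => (vtx (inl (b, a)) \in X)%:R)).
  by apply: eq_avg => a; rewrite (avg_cst s0.2).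
transitivity (avg (fun b => avg (fun a => (vtx (inr (b, a)) \in X)%:R)) : R);
  last by rewrite avg_pair; apply: eq_avg => -[].
rewrite -(avg_pair (fun b j => avg (fun s : secret => (vtx (inr (j, s.2)) \in X)%:R))).
rewrite (avg_cst p0.1); apply: eq_avg => j.
rewrite -(avg_pair (fun a r => (vtx (inr (j, r)) \in X)%:R)).
by rewrite (avg_cst s0.1).
Qed.

Lemma avg_expect (T O : finType) (L : 'I_k -> O -> R)
    (F : T -> {ffun 'I_k -> O} -> R) :
  avg (fun x => expect L (F x)) = expect L (fun y => avg (fun x => F x y)).
Proof.
by rewrite /expect avg_sum; apply: eq_bigr => y _; rewrite avgZ.
Qed.

Lemma avg_null_hits_le (Q : R) : 0 <= Q ->
  avg (fun tau : secrets => avg (fun t : secret => avg (fun c : bits =>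
    avg (fun phi : labels => avg (fun p : slot =>
      null_hits vtxI A cover (upd tau p.1 t) (upd c p false) phi p (tau p.1) Q)))))
  <= 2 * (Q * ((N%:R * B%:R)^-1 + (D%:R * rho%:R)^-1)).
Proof.
move=> Q0; set W := _ + _.
have W0 : 0 <= W by rewrite addr_ge0 ?invr_ge0 ?mulr_ge0.
have null0 tau c phi p s : 0 <= null_hits vtxI A cover tau c phi p s Q.
  by apply: sumr_ge0 => y _; rewrite mulr_ge0 ?prodr_ge0 // => l _; apply: law_ge0.
apply: (@le_trans _ _ (avg (fun tau : secrets => avg (fun t : secret =>
    2 * avg (fun c : bits => avg (fun phi : labels => avg (fun p : slot =>
      null_hits vtxI A cover (upd tau p.1 t) c phi p (tau p.1) Q))))))).
  apply: ler_avg => tau; apply: ler_avg => t.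
  exact: (@avg_upd_slot_le (fun c phi p =>
    null_hits vtxI A cover (upd tau p.1 t) c phi p (tau p.1) Q)).
under eq_avg => tau do rewrite avgZ.
rewrite avgZ ler_wpM2l // exchange_avg3.
rewrite -[leRHS](avg_cst ([ffun=> true] : bits)); apply: ler_avg => c.
rewrite exchange_avg3.
rewrite -[leRHS](avg_cst ([ffun=> i0] : labels)); apply: ler_avg => phi.
rewrite exchange_avg3.
(* Exchanging the tested secret with the fresh one: the graph is now drawn from [tau], and the
   tested secret is uniform and independent of it. *)
under eq_avg => p do rewrite (avg_upd p.1 (fun tau s =>
  null_hits vtxI A cover tau c phi p s Q)).
rewrite exchange_avg -[leRHS](avg_cst ([ffun=> s0] : secrets)).
apply: ler_avg => tau; rewrite /null_hits.
under eq_avg => p do rewrite avg_expect.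
rewrite avg_expect.
pose L l : output n -> R := A (block_piece tau c phi l); rewrite -/L.
have L1 : expect L (fun=> 1) = 1 by apply: expect1 => l; apply: law_sum1.
rewrite -[leRHS]mulr1 -[X in _ <= _ * X]L1 /expect mulr_sumr; apply: ler_sum => y _.
rewrite [leRHS]mulrCA ler_wpM2l ?prodr_ge0 // => [l _|]; first exact: law_ge0.
rewrite mulr1; have [XQ|XQ] := leP (#|composed_cover cover y|%:R) Q; last first.
  under eq_avg => p do under eq_avg => s do rewrite andbF.
  under eq_avg => p do rewrite (avg_cst s0).
  by rewrite (avg_cst p0) mulr_ge0.
under eq_avg => p do under eq_avg => s do rewrite andbT.
by apply: le_trans (avg_hits_le _) _; rewrite ler_wpM2r.
Qed.

(** * Near independence of a subgraph from most of the bits *)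

Section Gain.
Variables (tau : secrets) (t : secret) (Q : R).

Definition subgraph_law (phi : labels) (i : 'I_k) (c : bits) (T : graph n) : R :=
  \sum_(z | z.1 == T) A (block_piece tau c phi i) z.

Lemma subgraph_law_ge0 phi i c T : 0 <= subgraph_law phi i c T.
Proof. by apply: sumr_ge0 => z _; apply: law_ge0. Qed.

Lemma sum_subgraph_law phi i c (F : graph n -> R) :
  \sum_T F T * subgraph_law phi i c T = \sum_z A (block_piece tau c phi i) z * F z.1.
Proof.
rewrite [RHS](partition_big (fun z => z.1) xpredT) //=; apply: eq_bigr => T _.
by rewrite /subgraph_law mulr_sumr; apply: eq_bigr => z /eqP ->; rewrite mulrC.
Qed.

Lemma rest_hits_ge0_le1 c (phi : labels) p T :
  0 <= rest_hits vtxI A cover tau t c phi p Q T <= 1.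
Proof.
have L0 l z : 0 <= other_laws vtxI A tau t c phi p l z by exact: law_ge0.
rewrite sumr_ge0 => [|y _]; last by rewrite mulr_ge0 ?prodr_ge0.
rewrite -[leRHS](@expect1 R _ _ (other_laws vtxI A tau t c phi p)) => [|l].
  by apply: ler_expect => // y; case: (_ && _).
exact: law_sum1.
Qed.

Variables (phi : labels) (i : 'I_k).

Let S : {set slot} := [set q | phi q == i]%SET.

(** The possible messages once the secrets and labels are known; [xpredT] turns all potential edges
    on. *)
Let support : {set graph n} :=
  [set T : graph n | (T \subset block_piece tau xpredT phi i) && (#|T| <= h)%N]%SET.

Lemma block_piece_true_card :
  (#|block_piece tau xpredT phi i| <= #|S|)%N.
Proof.
apply: leq_trans (leq_imset_card _ _) _; apply/subset_leq_card/fintype.subsetP => q.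
by rewrite !inE.
Qed.

Lemma subgraph_law_support c T : subgraph_law phi i c T != 0 -> T \in support.
Proof.
apply: contraNT => Tn; rewrite /subgraph_law big1 // => z /eqP zT; apply/eqP.
apply: contraNT Tn => Az; rewrite inE -zT; apply/andP; split.
  apply: fintype.subset_trans (law_sub Az) _; apply/fintype.subsetP => e /imsetP[q].
  by rewrite inE => /andP[_ pq] ->; apply/imsetP; exists q.
by apply: leq_trans (Ah Az); rewrite leq_addr.
Qed.

(** The test depends only on the bits outside the piece of [i], the subgraph only on those
    inside. *)
Lemma subgraph_gain_mix c c' p : p \in alone_slots phi i ->
  subgraph_gain vtxI A cover tau t (mix S c c') phi p Q =
  \sum_T rest_hits vtxI A cover tau t c phi p Q T *
    (subgraph_law phi i (upd c' p true) T - subgraph_law phi i (upd c' p false) T).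
Proof.
rewrite inE => /andP[/eqP pi _]; rewrite /subgraph_gain pi.
have rhE T : rest_hits vtxI A cover tau t (mix S c c') phi p Q T =
             rest_hits vtxI A cover tau t c phi p Q T.
  apply: eq_bigr => y _; congr (_ * _); apply: eq_bigr => l _.
  rewrite /other_laws; case: (eqVneq l (phi p)) => // lp; congr (A _ _).
  apply: eq_spiece => // q ql; rewrite ffunE inE ql -pi (negbTE lp) //.
have bpE v : block_piece tau (upd (mix S c c') p v) phi i =
             block_piece tau (upd c' p v) phi i.
  by apply: eq_spiece => // q qi; rewrite !ffunE inE qi eqxx.
rewrite !bpE.
under eq_bigr => z _ do rewrite rhE.
under [X in _ - X]eq_bigr => z _ do rewrite rhE.
rewrite -!sum_subgraph_law -sumrB; apply: eq_bigr => T _; by rewrite mulrBr.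
Qed.

(** Turns the effect of switching a bit into a correlation with its sign, as needed for
    [signed_correlation_le]. *)
Lemma avg_subgraph_law_diff p T (a : R) :
  avg (fun c : bits => a *
    (subgraph_law phi i (upd c p true) T - subgraph_law phi i (upd c p false) T)) =
  2 * avg (fun c : bits => a * (chi R (c p) * subgraph_law phi i c T)).
Proof.
rewrite avgZ [in RHS]avgZ [RHS]mulrCA; congr (a * _).
under eq_avg => c do rewrite -mulN1r.
rewrite avgD avgZ !(avg_upd_bool p _ (fun c => subgraph_law phi i c T)).
rewrite [-1 * _]mulrCA -mulrDr -avgZ -avgD; congr (2 * _); apply: eq_avg => c.
by rewrite /chi; case: (c p); rewrite /= ?mul0r ?mul1r ?mulr0 ?addr0 ?add0r.
Qed.

Lemma avg_sum_subgraph_gain_le (lam zeta : R) : 0 < lam <= 1 / 2 -> 0 <= zeta ->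
  expR (- zeta) <= lam ^+ 2 ->
  avg (fun c : bits => \sum_(p in alone_slots phi i)
    subgraph_gain vtxI A cover tau t c phi p Q) <=
  2 * (3 * lam * #|S|%:R + (zeta * h%:R + 1) / lam).
Proof.
move=> lamP zeta0 zeta_lam; have /andP[lam0 lam2] := lamP.
(* Only the bits inside the piece are redrawn; the bound holds for every value [c] of the others. *)
rewrite (avg_mix false S) -[leRHS](avg_cst ([ffun=> true] : bits)).
apply: ler_avg => c.
under eq_avg => c' do under eq_bigr => p pS do rewrite subgraph_gain_mix //.
rewrite avg_sum.
under eq_bigr => p _ do (rewrite avg_sum;
  under eq_bigr => T _ do rewrite avg_subgraph_law_diff).
under eq_bigr => p _ do rewrite -mulr_sumr -avg_sum.
rewrite -mulr_sumr -avg_sum ler_wpM2l //.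
(* Balances the exponents: the number of messages costs zeta * h + lam ^+ 2 * #|S| and the moment 2
   * lam ^+ 2 * #|S|, so that subtracting lam * tt leaves 0. *)
pose tt := (3 * lam ^+ 2 * #|S|%:R + zeta * h%:R) / lam.
have tt0 : 0 <= tt.
  by rewrite divr_ge0 ?addr_ge0 ?mulr_ge0 ?exprn_ge0 // ltW.
apply: le_trans (signed_correlation_le (supp := support) _ lamP tt0 _ _ _ _) _.
- exact: subgraph_law_ge0.
- move=> c'; rewrite -(law_sum1 A (block_piece tau c' phi i)).
  have := sum_subgraph_law phi i c' (fun=> 1).
  under eq_bigr => T _ do rewrite mul1r.
  by under [X in _ = X -> _]eq_bigr => z _ do rewrite mulr1.
- exact: subgraph_law_support.
- by move=> p T; apply: rest_hits_ge0_le1.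
have -> : 3 * lam * #|S|%:R + (zeta * h%:R + 1) / lam = tt + 1 / lam.
  by rewrite /tt; field; rewrite gt_eqF.
rewrite lerD2l mulrA ler_wpM2r ?invr_ge0 ?(ltW lam0) //.
apply: (@le_trans _ _ (expR (zeta * h%:R + lam ^+ 2 * #|S|%:R) *
   expR (2 * lam ^+ 2 * #|S|%:R - lam * tt))).
  rewrite ler_pM ?expR_ge0 //.
    apply: le_trans (card_small_subsets _ _ zeta0) _.
    rewrite ler_expR lerD2l ler_pM ?expR_ge0 // ler_nat.
    exact: block_piece_true_card.
  rewrite ler_expR lerD2r ler_wpM2l ?mulr_ge0 ?exprn_ge0 ?(ltW lam0) // ler_nat.
  apply/subset_leq_card/fintype.subsetP => q; rewrite !inE.
  by move=> /andP[].
rewrite -expRD -[leRHS]expR0 ler_expR.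
rewrite [lam * tt]mulrC /tt divfK ?gt_eqF //; lra.
Qed.

End Gain.

(** The pieces partition the N * D slots, so the terms in the size of a piece average to 3 * lam,
    while the cost of a message is paid [k] times. *)
Lemma avg_subgraph_gain_le (Q lam zeta : R) : 0 < lam <= 1 / 2 -> 0 <= zeta ->
  expR (- zeta) <= lam ^+ 2 ->
  avg (fun tau : secrets => avg (fun t : secret => avg (fun c : bits =>
    avg (fun phi : labels => avg (fun p : slot =>
      (alone phi p)%:R * subgraph_gain vtxI A cover tau t c phi p Q))))) <=
  2 * (3 * lam + (zeta * h%:R + 1) / lam * k%:R / (N%:R * D%:R)).
Proof.
move=> lamP zeta0 zeta_lam.
rewrite -[leRHS](avg_cst ([ffun=> s0] : secrets)); apply: ler_avg => tau.
rewrite -[leRHS](avg_cst s0); apply: ler_avg => t.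
rewrite exchange_avg -[leRHS](avg_cst ([ffun=> i0] : labels)); apply: ler_avg => phi.
have ND0 : 0 < N%:R * D%:R :> R.
  by rewrite -natrM ltr0n muln_gt0 (leq_ltn_trans _ (ltn_ord p0.1)) //
    (leq_ltn_trans _ (ltn_ord p0.2)).
have -> : avg (fun c : bits => avg (fun p : slot =>
      (alone phi p)%:R * subgraph_gain vtxI A cover tau t c phi p Q)) =
    (N%:R * D%:R)^-1 * \sum_i avg (fun c : bits =>
      \sum_(p in alone_slots phi i) subgraph_gain vtxI A cover tau t c phi p Q).
  rewrite -avg_sum -avgZ; apply: eq_avg => c.
  rewrite {1}/avg card_prod !card_ord natrM.
  by rewrite (sum_aloneE phi (fun _ p => subgraph_gain vtxI A cover tau t c phi p Q)).
apply: (@le_trans _ _ ((N%:R * D%:R)^-1 * \sum_(i < k)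
   2 * (3 * lam * #|[set q | phi q == i]%SET|%:R + (zeta * h%:R + 1) / lam))).
  rewrite ler_wpM2l ?invr_ge0 ?(ltW ND0) //; apply: ler_sum => i _.
  exact: avg_sum_subgraph_gain_le.
rewrite -mulr_sumr big_split /= -mulr_sumr sumr_const card_ord -natr_sum.
have -> : (\sum_(i < k) #|[set q | phi q == i]%SET| = N * D)%N.
  rewrite -[in RHS](card_ord N) -[in RHS](card_ord D) -card_prod -sum1_card.
  rewrite (partition_big phi xpredT) //=; apply: eq_bigr => i _.
  by rewrite sum1dep_card.
rewrite natrM -[X in _ + X]mulr_natr le_eqVlt; apply/orP; left; apply/eqP.
have [N0 D0] : N%:R != 0 :> R /\ D%:R != 0 :> R.
  by split; apply: contraTneq ND0 => ->; rewrite ?mul0r ?mulr0 ltxx.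
by field; rewrite N0 D0 gt_eqF //; case/andP: lamP.
Qed.

(** Union bound over the other D - 1 slots of the block. *)
Lemma avg_not_alone_le :
  avg (fun phi : labels => avg (fun p : slot => (~~ alone phi p)%:R)) <=
  D.-1%:R / k%:R :> R.
Proof.
rewrite exchange_avg -[leRHS](avg_cst p0); apply: ler_avg => p.
apply: (@le_trans _ _ (avg (fun phi : labels =>
    \sum_(j | j != p.2) (phi (p.1, j) == phi p)%:R))).
  apply: ler_avg => phi; have [|] := boolP (alone phi p); first by rewrite sumr_ge0.
  rewrite negb_forall => /existsP[[b j]]; rewrite negb_imply /=.
  move=> /andP[/andP[/eqP -> e] pj].
  have jp : j != p.2 by apply: contraNneq pj => ->; case: (p).
  by rewrite (bigD1 j) //= e lerDl sumr_ge0.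
rewrite avg_sum (eq_bigr (fun=> k%:R^-1)) => [|j jp].
  by rewrite sumr_const cardC1 card_ord mulr_natl.
have pj : (p.1, j) != p by apply: contraNneq jp => /(congr1 snd) /= ->.
rewrite (avg_ffun2 i0 (fun i i' => (i == i')%:R) pj).
by under eq_avg => i do rewrite avg_eq; rewrite (avg_cst i0) card_ord.
Qed.

(** The guarantee holds for every planted graph, hence on average. The terms account in turn for a
    slot that is not alone, the fixed solution, the change of subgraph, and a chance hit by an
    independent cover. *)
Lemma success_bound (alpha eps lam zeta : R) : 0 <= alpha ->
  0 < lam <= 1 / 2 -> 0 <= zeta -> expR (- zeta) <= lam ^+ 2 ->
  (forall G, 1 - eps <= success_prob k A cover alpha G) ->
  1 - eps <= D.-1%:R / k%:R +
    2 * ((2 * h%:R * k%:R + N%:R * N%:R * D%:R / (k%:R * rho%:R)) / (N%:R * D%:R)) +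
    2 * (3 * lam + (zeta * h%:R + 1) / lam * k%:R / (N%:R * D%:R)) +
    2 * ((alpha * N.+1%:R + h%:R) * ((N%:R * B%:R)^-1 + (D%:R * rho%:R)^-1)).
Proof.
move=> alpha0 lamP zeta0 zeta_lam HA.
pose succ (tau : secrets) (t : secret) (c : bits) (phi : labels) (p : slot) : R := expect
  (fun l => A (spiece vtxI (planted tau t p) (upd c p true) phi l))
  (fun y => (good_cover alpha (sgraph vtxI (planted tau t p) (upd c p true))
      (composed_cover cover y))%:R).
pose Q := alpha * N.+1%:R.
pose f1 (phi : labels) (p : slot) : R := (~~ alone phi p)%:R.
pose f2 tau c (phi : labels) p : R :=
  (alone phi p)%:R * fixed_hits vtxI A tau (upd c p true) phi p.
pose f3 tau t c (phi : labels) p : R :=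
  (alone phi p)%:R * subgraph_gain vtxI A cover tau t c phi p Q.
pose f4 tau t c (phi : labels) p : R :=
  null_hits vtxI A cover (upd tau p.1 t) (upd c p false) phi p (tau p.1) (Q + h%:R).
have L0 tau t (c : bits) (phi : labels) p (l : 'I_k) z :
    0 <= A (spiece vtxI (planted tau t p) (upd c p true) phi l) z by exact: law_ge0.
have succ_le tau t c phi p :
    succ tau t c phi p <= f1 phi p + f2 tau c phi p + f3 tau t c phi p + f4 tau t c phi p.
  have f4_ge0 : 0 <= f4 tau t c phi p.
    by apply: sumr_ge0 => y _; rewrite mulr_ge0 ?prodr_ge0 // => l _; apply: law_ge0.
  rewrite /f1 /f2 /f3; have [ph|_] /= := boolP (alone phi p).
    by rewrite add0r !mul1r; apply: planted_success_le.
  rewrite !mul0r !addr0 -[leLHS]addr0 lerD //.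
  rewrite -[leRHS](@expect1 R _ _ (fun l =>
    A (spiece vtxI (planted tau t p) (upd c p true) phi l))) => [|l].
    by apply: ler_expect => // y; case: good_cover.
  exact: law_sum1.
have : 1 - eps <= avg (fun tau : secrets => avg (fun t : secret => avg (fun c : bits =>
    avg (fun phi : labels => avg (fun p : slot => f1 phi p + f2 tau c phi p +
      f3 tau t c phi p + f4 tau t c phi p))))).
  rewrite -[leLHS](avg_cst ([ffun=> s0] : secrets)); apply: ler_avg => tau.
  rewrite -[leLHS](avg_cst s0); apply: ler_avg => t.
  rewrite -[leLHS](avg_cst ([ffun=> true] : bits)); apply: ler_avg => c.
  rewrite exchange_avg -[leLHS](avg_cst p0); apply: ler_avg => p.
  apply: le_trans (HA (sgraph vtxI (planted tau t p) (upd c p true))) _.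
  by rewrite (success_sgraph vtxI A cover alpha _ _ i0); apply: ler_avg => phi; apply: succ_le.
move=> /le_trans; apply.
under eq_avg => tau do under eq_avg => t do under eq_avg => c do
  under eq_avg => phi do rewrite !avgD.
under eq_avg => tau do under eq_avg => t do under eq_avg => c do rewrite !avgD.
under eq_avg => tau do under eq_avg => t do rewrite !avgD.
under eq_avg => tau do rewrite !avgD.
rewrite !avgD; apply: lerD; [apply: lerD; [apply: lerD|]|].
- under eq_avg => tau do under eq_avg => t do rewrite (avg_cst ([ffun=> true] : bits)).
  under eq_avg => tau do rewrite (avg_cst s0).
  by rewrite (avg_cst ([ffun=> s0] : secrets)); apply: avg_not_alone_le.
- under eq_avg => tau do rewrite (avg_cst s0).
  exact: avg_fixed_hits_le.
- exact: avg_subgraph_gain_le.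
- apply: avg_null_hits_le.
  by rewrite addr_ge0 ?mulr_ge0.
Qed.

End Estimates.

(** * Parameters *)

Lemma ex_block_embedding (n N B D rho : nat) : (N * B + D * rho <= n)%N ->
  exists vtx : ('I_N * 'I_B) + ('I_D * 'I_rho) -> 'I_n, injective vtx.
Proof.
move=> le_n.
have card_le : (#|{: ('I_N * 'I_B) + ('I_D * 'I_rho)}| <= n)%N.
  by rewrite card_sum !card_prod !card_ord.
exists (fun x => widen_ord card_le (enum_rank x)) => x y e.
by apply: enum_rank_inj; apply: val_inj; apply: (congr1 val e).
Qed.

Lemma output_size_le (R : realType) n (A : coreset R n) (H : graph n) z :
  A H z != 0 -> (output_size z <= coreset_size A)%N.
Proof.
move=> Az; apply: leq_trans (leq_bigmax H).
exact: (@leq_bigmax_cond _ (fun y => A H y != 0) (@output_size n)).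
Qed.

(** Allows zeta = 12 with lam = 1 / 50; it follows from e >= 2 and 2 ^ 12 >= 50 ^ 2. *)
Lemma expRN12_le (R : realType) : expR (- 12) <= (1 / 50) ^+ 2 :> R.
Proof.
have e1 : 2 <= expR 1 :> R by have := expR_ge1Dx (1 : R); lra.
have e12 : 2 ^+ 12 <= expR 12 :> R.
  have -> : 12 = 12%:R * 1 :> R by rewrite mulr1.
  by rewrite expRM_natl lerXn2r // nnegrE ?expR_ge0.
rewrite expRN -[leRHS]invrK lef_pV2 ?posrE ?expR_gt0 ?invr_gt0 ?exprn_gt0 //; lra.
Qed.

Lemma double_divn_ge (n m : nat) : (0 < m <= n)%N -> (n <= 2 * (m * (n %/ m)))%N.
Proof.
move=> /andP[m0 mn]; have q0 : (0 < n %/ m)%N by rewrite divn_gt0.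
apply: leq_trans (ltnW (ltn_ceil n m0)) _.
rewrite mulnC [leqRHS]mulnCA leq_mul2l; apply/orP; right.
by rewrite mul2n -addnn -addn1 leq_add2l.
Qed.

(** [Dp] stands for D - 1. The four summands are at most 1/2, 2/100, 36/100 and 48/1000. *)
Lemma numeric_bound (R : realType) (n k N B D rho h alpha Dp : R) :
  0 < n -> 0 < k -> 0 < B -> 0 < D -> 0 < rho -> 0 <= h ->
  4 * 10 ^+ 3 <= N -> 2 * 10 ^+ 4 * h <= N -> 1 <= alpha ->
  10 ^+ 3 * (alpha * N) <= n ->
  2 * Dp <= k -> k <= 2 * D -> D <= k -> n <= 4 * (N * B) -> n <= 4 * (D * rho) ->
  Dp / k + 2 * ((2 * h * k + N * N * D / (k * rho)) / (N * D)) +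
    2 * (3 * (1 / 50) + (12 * h + 1) / (1 / 50) * k / (N * D)) +
    2 * ((alpha * (N + 1) + h) * ((N * B)^-1 + (D * rho)^-1)) <= 19 / 20.
Proof.
move=> n0 k0 B0 D0 rho0 h0 N_ge hN alpha1 alphaN Dpk kD Dk nNB nDrho.
have N0 : 0 < N by lra.
have alphaN0 : N <= alpha * N by rewrite ler_peMl // ltW.
have Dpk2 : Dp / k <= 1 / 2 by rewrite ler_pdivrMr //; lra.
have kND : k / (N * D) <= 2 / N.
  by rewrite ler_pdivrMr ?mulr_gt0 // mulrA divfK ?gt_eqF.
have hNle : h / N <= 1 / (2 * 10 ^+ 4) by rewrite ler_pdivrMr //; lra.
have Ninv : 1 / N <= 1 / (4 * 10 ^+ 3) by rewrite ler_pdivrMr //; lra.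
have T1 : (2 * h * k + N * N * D / (k * rho)) / (N * D) <= 1 / 100.
  have -> : (2 * h * k + N * N * D / (k * rho)) / (N * D) =
      2 * (h * (k / (N * D))) + N / (k * rho).
    by field; rewrite !gt_eqF.
  have i1 : N / (k * rho) <= 4 / 10 ^+ 3.
    rewrite ler_pdivrMr ?mulr_gt0 //.
    have : D * rho <= k * rho by rewrite ler_pM2r.
    clear - alphaN0 alphaN nDrho; lra.
  have : h * (k / (N * D)) <= h * (2 / N) by rewrite ler_wpM2l.
  have -> : h * (2 / N) = 2 * (h / N) by rewrite mulrCA.
  clear - hNle i1; lra.
have T2 : (12 * h + 1) / (1 / 50) * k / (N * D) <= 12 / 100.
  have : (12 * h + 1) * (k / (N * D)) <= (12 * h + 1) * (2 / N).
    by rewrite ler_wpM2l // addr_ge0 ?mulr_ge0.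
  have -> : (12 * h + 1) * (2 / N) = 24 * (h / N) + 2 * (1 / N).
    by field; rewrite gt_eqF.
  have -> : (12 * h + 1) / (1 / 50) * k / (N * D) =
      50 * ((12 * h + 1) * (k / (N * D))) by field; rewrite !gt_eqF.
  clear - hNle Ninv; lra.
have T3 : (alpha * (N + 1) + h) * ((N * B)^-1 + (D * rho)^-1) <= 24 / 10 ^+ 3.
  have invle (x : R) : 0 < x -> n <= 4 * x -> x^-1 <= 4 / n.
    by move=> x0 nx; rewrite ler_pdivlMr // mulrC ler_pdivrMr.
  have i1 := invle _ (mulr_gt0 N0 B0) nNB.
  have i2 := invle _ (mulr_gt0 D0 rho0) nDrho.
  (* Each of alpha * N, alpha and h is at most n / 10 ^+ 3. *)
  apply: (@le_trans _ _ ((3 / 10 ^+ 3 * n) * (4 / n + 4 / n))).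
    apply: ler_pM.
    - by rewrite addr_ge0 ?mulr_ge0 ?addr_ge0 ?(ltW N0) // (le_trans ler01 alpha1).
    - by rewrite addr_ge0 ?invr_ge0 ?mulr_ge0 ?ltW.
    - have : alpha <= alpha * N by rewrite ler_peMr ?(le_trans ler01 alpha1) //; lra.
      clear - alphaN0 alphaN hN h0; lra.
    - by rewrite lerD.
  by rewrite le_eqVlt; apply/orP; left; apply/eqP; field; rewrite gt_eqF.
clear - Dpk2 T1 T2 T3; lra.
Qed.

Lemma uphalf_bounds (k : nat) :
  (2 * uphalf k <= k.+1)%N /\ (k <= 2 * uphalf k)%N.
Proof. by rewrite uphalf_half; have := odd_double_half k; lia. Qed.

Lemma coreset_size_lower_bound (R : realType) (n k : nat) (A : coreset R n)
    (cover : graph n -> {set 'I_n}) (alpha eps : R) :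
  (0 < k < n)%N -> 1 <= alpha -> 5 * 10 ^+ 3 <= n%:R / (10 ^+ 3 * alpha) ->
  eps < 1 / 20 ->
  (forall G, 1 - eps <= success_prob k A cover alpha G) ->
  n%:R / (10 ^+ 3 * alpha) <= 4 * 10 ^+ 4 * (coreset_size A)%:R.
Proof.
move=> /andP[k0 kn] alpha1 N_ge eps10 HA; set h := coreset_size A.
have alpha0 : 0 <= alpha by exact: le_trans ler01 alpha1.
have alpha_gt0 : 0 < 10 ^+ 3 * alpha.
  by rewrite mulr_gt0 ?exprn_gt0 // (lt_le_trans ltr01).
have [N [Nle ltN]] : exists N : nat, N%:R <= n%:R / (10 ^+ 3 * alpha) /\
    n%:R / (10 ^+ 3 * alpha) < N%:R + 1.
  exists (Num.truncn (n%:R / (10 ^+ 3 * alpha))); rewrite natr1.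
  by apply/andP/truncn_itv; rewrite divr_ge0 ?ler0n ?(ltW alpha_gt0).
have N4000 : 4 * 10 ^+ 3 <= N%:R :> R by clear - ltN N_ge; lra.
have hN2 : 2 * N%:R >= n%:R / (10 ^+ 3 * alpha) by clear - ltN N4000; lra.
(* At most half of the vertices go to the blocks and half to the classes. Rounding k / 2 up keeps
   [D] positive, while D - 1 is still at most k / 2. *)
pose D := uphalf k; pose B := (n %/ (2 * N))%N; pose rho := (n %/ (2 * D))%N.
have rN : 0 < N%:R :> R by clear - N4000; lra.
have N0 : (0 < N)%N by rewrite ltr0n in rN.
have alphaN : 10 ^+ 3 * (alpha * N%:R) <= n%:R.
  by move: Nle; rewrite ler_pdivlMr // mulrC mulrA.
have N2n : (2 * N <= n)%N.
  rewrite -(ler_nat R) natrM; apply: le_trans alphaN.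
  have : N%:R <= alpha * N%:R by rewrite ler_peMl.
  clear - rN; lra.
have D0 : (0 < D)%N by rewrite /D uphalf_gt0.
have [Dk kD] : (2 * D <= k.+1)%N /\ (k <= 2 * D)%N.
  exact: uphalf_bounds.
have D2n : (2 * D <= n)%N by apply: leq_trans Dk kn.
have nNB : (n <= 4 * (N * B))%N.
  have := @double_divn_ge n (2 * N); rewrite muln_gt0 N0 N2n => /(_ isT).
  by rewrite -/B -mulnA mulnA.
have nDrho : (n <= 4 * (D * rho))%N.
  have := @double_divn_ge n (2 * D); rewrite muln_gt0 D0 D2n => /(_ isT).
  by rewrite -/rho -mulnA mulnA.
have NBn : (2 * (N * B) <= n)%N by rewrite mulnA mulnC leq_trunc_div.
have Drhon : (2 * (D * rho) <= n)%N by rewrite mulnA mulnC leq_trunc_div.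
have n0 : (0 < n)%N by apply: leq_ltn_trans kn.
have B0 : (0 < B)%N by rewrite divn_gt0 ?muln_gt0.
have rho0 : (0 < rho)%N by rewrite divn_gt0 ?muln_gt0.
have [vtx vtxI] : exists vtx : ('I_N * 'I_B) + ('I_D * 'I_rho) -> 'I_n,
    injective vtx.
  apply: ex_block_embedding; rewrite -(leq_pmul2l (isT : 0 < 2)%N) mulnDr.
  by rewrite [leqRHS]mul2n -addnn leq_add.
have lamP : 0 < (1 / 50 : R) <= 1 / 2 by apply/andP; split; clear; lra.
have := success_bound vtxI (Ordinal N0, Ordinal D0) (Ordinal B0, Ordinal rho0)
  (Ordinal k0) (@output_size_le _ _ A) alpha0 lamP (ler0n R 12) (expRN12_le R) HA.
(* If [h] exceeds N / (2 * 10 ^+ 4) the claim holds, [N] being at least half of its unrounded value.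
   Otherwise the success probability would be at most 19/20. *)
rewrite -/h; have [hN|hN] := leP (2 * 10 ^+ 4 * h%:R) (N%:R : R); last first.
  by clear - hN hN2; lra.
rewrite -natr1 => success_le.
have := @numeric_bound R n%:R k%:R N%:R B%:R D%:R rho%:R h%:R alpha D.-1%:R.
rewrite !ltr0n ler0n -!natrM !ler_nat !natrM.
have -> : (2 * D.-1 <= k)%N by clear - Dk; lia.
have -> : (D <= k)%N by clear - Dk k0; lia.
move=> /(_ n0 k0 B0 D0 rho0 isT N4000 hN alpha1 alphaN isT kD isT nNB nDrho).
by clear - success_le eps10; lra.
Qed.

(** With a ratio below 1, no cover of the complete graph is good and success has probability 0; two
    vertices ensure an edge, hence a positive minimum. *)
Lemma approx_ratio_ge1 (R : realType) (n k : nat) (A : coreset R n)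
    (cover : graph n -> {set 'I_n}) (alpha eps : R) :
  (1 < n)%N -> eps < 1 ->
  (forall G, 1 - eps <= success_prob k A cover alpha G) -> 1 <= alpha.
Proof.
move=> n1 eps1 /(_ [set: edge n]%SET) HA; rewrite leNgt; apply/negP => alpha1.
have e_card : #|[set Ordinal (ltnW n1); Ordinal n1]%SET| == 2%N by rewrite cards2.
have VC0 := VC_gt0 (finset.in_setT (exist (fun e : {set 'I_n} => #|e| == 2%N) _ e_card)).
move: HA; rewrite /success_prob big1 ?mulr0; first by rewrite leNgt subr_gt0 eps1.
move=> f _; rewrite big_pred0 // => y; apply/negbTE/negP => /andP[/VC_le VCle].
apply/negP; rewrite -ltNge.
set X := composed_cover _ _ in VCle *.
apply: (@lt_le_trans _ _ (VC [set: edge n]%SET)%:R); last by rewrite ler_nat.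
by rewrite gtr_pMl ?ltr0n.
Qed.

Lemma params_in_range (R : realType) (n k : nat) (alpha : R) :
  (1 < n)%N -> 1 <= alpha ->
  `|alpha| <= 10 ^- 7 * `|Num.min (n%:R / k%:R) k%:R| ->
  (0 < k < n)%N /\ 5 * 10 ^+ 3 <= n%:R / (10 ^+ 3 * alpha).
Proof.
move=> n1 alpha1 alpha_le.
have n0 : 0 < n%:R :> R by rewrite ltr0n (ltn_trans _ n1).
have alpha0 : 0 < alpha by apply: lt_le_trans alpha1.
(* Since division by 0 gives 0, k = 0 would make the minimum 0 and force alpha = 0. *)
have k0 : (0 < k)%N.
  rewrite lt0n; apply/eqP => k0; move: alpha_le.
  by rewrite k0 invr0 mulr0 minxx normr0 mulr0 normr_le0 gt_eqF.
have rk0 : 1 <= k%:R :> R by rewrite ler1n.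
have rk_gt0 : 0 < k%:R :> R by rewrite ltr0n.
have {alpha_le} alpha_le : alpha * k%:R <= 10 ^- 7 * n%:R.
  rewrite -ler_pdivlMr // -mulrA; move: alpha_le; rewrite gtr0_norm // => /le_trans; apply.
  rewrite ler_wpM2l ?invr_ge0 ?exprn_ge0 //.
  have min_ge0 : 0 <= Num.min (n%:R / k%:R) k%:R :> R by rewrite le_min divr_ge0 ?ler0n.
  by rewrite ger0_norm // ge_min lexx.
have {}alpha_le : 10 ^+ 7 * (alpha * k%:R) <= n%:R.
  by move: alpha_le; rewrite [10 ^- 7 * _]mulrC ler_pdivlMr ?exprn_gt0 // [_ * 10 ^+ 7]mulrC.
have k_le : k%:R <= alpha * k%:R by rewrite ler_peMl // ltW.
have alpha_le_k : alpha <= alpha * k%:R by rewrite ler_peMr // ltW.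
split.
  rewrite k0 -(ltr_nat R) /=; move: k_le alpha_le n0.
  by move: (n%:R : R) (k%:R : R) (alpha * k%:R) => M K P; clear; lra.
rewrite ler_pdivlMr ?mulr_gt0 ?exprn_gt0 //.
move: alpha_le_k alpha_le alpha0.
by move: (n%:R : R) (alpha * k%:R) => M P; clear; lra.
Qed.

(** * The asymptotic lower bound *)

Local Open Scope classical_set_scope.

Theorem theorem4 (R : realType) (k : nat -> nat) (alpha : nat -> R)
    (A : forall n : nat, coreset R n)
    (k_small : (fun n : nat => (k n)%:R : R) =o_\oo
               (fun n : nat => n%:R / ln n%:R : R))
    (alpha_small : alpha =o_\oo
               (fun n : nat => Num.min (n%:R / (k n)%:R) (k n)%:R : R))
    (A_approx : approx_coreset k alpha A) :
  (fun n : nat => (coreset_size (A n))%:R : R) \is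
    'Omega_\oo (fun n : nat => n%:R / alpha n : R).
Proof.
case: A_approx => cover _ [eps eps0 HA].
(* The constant collects the factors 10 ^+ 3 and 4 * 10 ^+ 4 of [coreset_size_lower_bound]. *)
rewrite qualifE /=; apply/asboolP; exists (4 * 10 ^+ 7)^-1.
  by rewrite invr_gt0 mulr_gt0 ?exprn_gt0.
have alpha_near : \forall n \near \oo,
    `|alpha n| <= 10 ^- 7 * `|Num.min (n%:R / (k n)%:R) (k n)%:R|.
  by move/eqoP: alpha_small; apply; rewrite invr_gt0 exprn_gt0.
have eps_near : \forall n \near \oo, eps n < 1 / 20.
  by apply: (cvgr_lt 0) => //; lra.
near=> n.
have n1 : (1 < n)%N by near: n; exact: nbhs_infty_gt.
have epsn : eps n < 1 / 20 by near: n.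
have alphan : `|alpha n| <= 10 ^- 7 * `|Num.min (n%:R / (k n)%:R) (k n)%:R|.
  by near: n.
have epsn1 : eps n < 1 by clear - epsn; lra.
have alpha1 := approx_ratio_ge1 n1 epsn1 (HA n).
have [kn nalpha] := params_in_range n1 alpha1 alphan.
have size_ge := coreset_size_lower_bound kn alpha1 nalpha epsn (HA n).
have alpha0 : 0 < alpha n by apply: lt_le_trans alpha1.
have na0 : 0 <= n%:R / alpha n by rewrite divr_ge0 // ltW.
rewrite (ger0_norm na0) [leRHS]ger0_norm //.
rewrite mulrC ler_pdivrMr ?mulr_gt0 ?exprn_gt0 //.
move: size_ge; rewrite invfM mulrCA mulrC ler_pdivrMr ?exprn_gt0 //.
by clear; lra.
Unshelve. all: by end_near.
Qed.
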